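(* Let $G$ be a finite simple connected graph with $n$ vertices, $m$ edges, and minimum degree $\delta(G)\geq 2$. Then \[ cvc(G)\geq 2n-m-1. \] Moreover, equality holds if and only if $G$ has a connected vertex cover $C$ such that $G[C]$ is a tree and every vertex in $V(G)\setminus C$ has degree two (in $G$). When equality holds, every minimum connected vertex cover $C$ of $G$ has these two properties.
   Context: A vertex cover of $G$ is a set of vertices meeting every edge; a connected vertex cover is a vertex cover that induces a connected subgraph. $cvc(G)$ is the minimum size of a connected vertex cover of $G$, and a minimum connected vertex cover is one of size $cvc(G)$. $G[C]$ is the subgraph induced by $C$. *)

(* Defs.v *)
From mathcomp Require Import all_boot.

Set Implicit Arguments.
Unset Strict Implicit.
Unset Printing Implicit Defensive.

Record sgraph := SGraph {
  vertex :> finType;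
  adj : rel vertex;
  adj_sym : symmetric adj;
  adj_irrefl : irreflexive adj
}.

Section Graph.
Variable G : sgraph.

(* An edge is the unordered pair of its ends, so #|edges| counts each edge
   once. *)
Definition edges : {set {set G}} :=
  [set A : {set G} | [exists x : G, exists y : G, adj x y && (A == [set x; y])]].

Definition degree (x : G) : nat := #|[set y | adj x y]|.

(* Degrees are smaller than #|G|, so the initial value #|G| does not affect the
   minimum unless G has no vertex. *)
Definition min_degree : nat := \big[minn/#|G|]_(x : G) degree x.

Definition connected_graph : bool :=
  (0 < #|G|) && [forall x : G, forall y : G, connect (@adj G) x y].

(* [ucycle] requires distinct vertices; cyclic sequences of size 2 just
   traverse one edge back and forth. *)
Definition acyclic_graph : Prop :=
  forall c : seq G, ucycle (@adj G) c -> size c <= 2.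

Definition is_tree : Prop := connected_graph /\ acyclic_graph.

Definition vertex_cover (C : {set G}) : bool :=
  [forall A in edges, C :&: A != set0].

End Graph.

Section Induced.
Variables (G : sgraph) (C : {set G}).

Definition induced_adj : rel {x : G | x \in C} :=
  fun u v => adj (val u) (val v).

Lemma induced_adj_sym : symmetric induced_adj.
Proof. by move=> u v; apply: adj_sym. Qed.

Lemma induced_adj_irrefl : irreflexive induced_adj.
Proof. by move=> u; apply: adj_irrefl. Qed.

Definition induced : sgraph := SGraph induced_adj_sym induced_adj_irrefl.

End Induced.

Section ConnectedVertexCover.
Variable G : sgraph.

Definition connected_vertex_cover (C : {set G}) : bool :=
  vertex_cover C && connected_graph (induced C).

(* When G is connected, [set: G] is a connected vertex cover, so this is the
   minimum over a nonempty family; otherwise the value may be a default. *)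
Definition cvc : nat :=
  #|[arg min_(C < [set: G] | connected_vertex_cover C) #|C| ]|.

Definition minimum_connected_vertex_cover (C : {set G}) : Prop :=
  connected_vertex_cover C /\ #|C| = cvc.

End ConnectedVertexCover.

(* Main.v *)
Require Import Defs.
From mathcomp Require Import all_boot all_order all_algebra.
From mathcomp Require Import zify.

Set Implicit Arguments.
Unset Strict Implicit.
Unset Printing Implicit Defensive.

(** The complement of a vertex cover [C] is independent, so the [m] edges split
    into those of [G[C]] and, for each [v] outside [C], the [degree v] edges at
    [v].  Connectedness of [G[C]] gives at least [#|C| - 1] edges of the first
    kind, with equality exactly for trees, and [min_degree G >= 2] gives at
    least [2 * (n - #|C|)] edges of the second kind, with equality exactly when
    all the vertices outside [C] have degree two.  Hence
    [m >= #|C| - 1 + 2 * (n - #|C|)], that is [#|C| >= 2 * n - m - 1], for every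
    connected vertex cover, and equality means that both counts are tight
    ([connected_cover_bound] and [connected_cover_bound_eq]).  The claims on
    [cvc] follow by taking [C] minimum; a cover that satisfies the two
    conditions attains the lower bound, so it is minimum.

    The edge count of trees uses a rooted spanning tree: every vertex [v] other
    than the root gets a parent that is strictly nearer to the root, and the
    edges from a vertex to its parent are pairwise distinct.  There are
    [#|H| - 1] of them, and they are all the edges of [H] exactly when [H] is
    acyclic. *)

(** * Edges as unordered pairs *)

Lemma set2_inj (T : finType) (a b c d : T) :
  [set a; b] = [set c; d] -> (a = c /\ b = d) \/ (a = d /\ b = c).
Proof.
move=> eqs.
have := set21 a b; have := set22 a b; rewrite eqs !inE.
have := set21 c d; have := set22 c d; rewrite -eqs !inE.
do 4![case/orP=> /eqP ?]; subst; by [left | right].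
Qed.

Section Edges.
Variable G : sgraph.

Lemma edgesP (A : {set G}) :
  reflect (exists x y, adj x y /\ A = [set x; y]) (A \in edges G).
Proof.
rewrite inE; apply: (iffP existsP) => [[x /existsP[y /andP[xy /eqP->]]]|].
  by exists x, y.
by case=> x [y [xy ->]]; exists x; apply/existsP; exists y; rewrite xy eqxx.
Qed.

Lemma mem_edges (x y : G) : adj x y -> [set x; y] \in edges G.
Proof. by move=> xy; apply/edgesP; exists x, y. Qed.

Lemma leq_min_degree (v : G) : min_degree G <= degree v.
Proof.
rewrite /min_degree; elim: index_enum (mem_index_enum v) => // x s IHs.
by rewrite inE big_cons geq_min => /predU1P[->|/IHs->]; rewrite ?leqnn ?orbT.
Qed.

End Edges.

(** * Edge counts of connected graphs and of trees *)

Section SpanningTree.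
Variable G : sgraph.
Implicit Types (r v : G) (p : G -> G).

(** The parent of a vertex is its predecessor on a shortest path from the root,
    and [d] is the length of such a path.  Only the strict decrease of [d]
    matters afterwards. *)
Lemma spanning_tree_exists r :
  (forall v, connect (@adj G) r v) ->
  exists p (d : G -> nat),
    forall v, v != r -> adj v (p v) /\ d (p v) < d v.
Proof.
move=> conn.
pose walk v n := [exists t : n.-tuple G, path (@adj G) r t && (last r t == v)].
have walkP v (s : seq G) : path (@adj G) r s -> last r s = v -> walk v (size s).
  by move=> rs sv; apply/existsP; exists (in_tuple s); rewrite /= rs sv eqxx.
have ex v : exists n, walk v n.
  by case/connectP: (conn v) => s rs sv; exists (size s); apply: walkP.
pose d v := ex_minn (ex v).
exists (fun v => odflt r [pick u | adj v u && (d u < d v)]), d => v vr.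
case: pickP => [u /andP[] //|none]; exfalso.
have : walk v (d v) by rewrite /d; case: ex_minnP.
case/existsP=> t /andP[]; have := size_tuple t.
case/lastP: (tval t) => [|s w] dE; first by rewrite /= eq_sym (negPf vr).
rewrite rcons_path last_rcons => /andP[rs sw] /eqP wv; subst w.
(* The last but one vertex of a shortest walk to [v] would be a parent. *)
have := none (last r s); rewrite adj_sym sw /= -dE size_rcons ltnS.
rewrite /d; case: ex_minnP => k _ kmin.
by rewrite kmin //; apply: walkP.
Qed.

Section Rooted.
Variables (r : G) (p : G -> G) (d : G -> nat).
Hypothesis parentP : forall v, v != r -> adj v (p v) /\ d (p v) < d v.

Definition tree_edges : {set {set G}} :=
  [set [set v; p v] | v in [set~ r]].

Lemma tree_edges_sub : tree_edges \subset edges G.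
Proof.
apply/subsetP=> _ /imsetP[v vr ->]; rewrite !inE in vr.
by apply: mem_edges; case: (parentP vr).
Qed.

(** Two vertices with the same parent edge would be parents of each other,
    which the strict decrease of [d] forbids. *)
Lemma card_tree_edges : #|tree_edges|.+1 = #|G|.
Proof.
rewrite card_in_imset ?cardsC1.
  by rewrite prednK //; apply/card_gt0P; exists r.
move=> v w; rewrite !inE => vr wr /set2_inj[[]//|[vpw pvw]].
have [_] := parentP vr; have [_] := parentP wr.
by rewrite pvw -vpw => vw /(ltn_trans vw); rewrite ltnn.
Qed.

Lemma tree_edgeP u v :
  reflect ((u != r /\ v = p u) \/ (v != r /\ u = p v))
          ([set u; v] \in tree_edges).
Proof.
apply: (iffP imsetP) => [[w]|].
  by rewrite !inE => wr /set2_inj[] [-> ->]; [left | right].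
case=> [[ur ->]|[vr ->]]; first by exists u; rewrite ?inE.
by exists v; rewrite ?inE // setUC.
Qed.

(** In a cycle of tree edges, both neighbours of a vertex that maximizes [d]
    would be its parent. *)
Lemma tree_edges_acyclic : edges G = tree_edges -> acyclic_graph G.
Proof.
move=> all_tree c /andP[cyc Uc]; rewrite leqNgt; apply/negP=> c_gt2.
have [x0 x0c] : exists x, x \in c.
  by case: (c) c_gt2 => // x s _; exists x; rewrite mem_head.
case: (arg_maxnP d x0c) => x xc xmax.
have [i s def_c] := rot_to xc.
have {}cyc : cycle (@adj G) (x :: s) by rewrite -def_c rot_cycle.
have {}Uc : uniq (x :: s) by rewrite -def_c rot_uniq.
have {}xmax y : y \in x :: s -> d y <= d x.
  by rewrite -def_c mem_rot => /xmax.
have {}c_gt2 : 2 < size (x :: s) by rewrite -def_c size_rot.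
have nbr y : y \in x :: s -> adj x y -> y = p x.
  move=> ys /mem_edges; rewrite all_tree => /tree_edgeP[[]//|[yr xE]].
  by have [_] := parentP yr; rewrite -xE ltnNge xmax.
(* The two neighbours of [x] on the cycle are the ends of the rest of it. *)
case: s cyc Uc xmax c_gt2 nbr {def_c} => [|y s] //.
case/lastP: s => [|s z] //= cyc Uc _ _ nbr.
move: cyc; rewrite rcons_path last_rcons => /and3P[xy _ zx].
have ey : y = p x by apply: nbr; rewrite // !inE eqxx orbT.
have ez : z = p x.
  by apply: nbr; rewrite 1?adj_sym // !inE mem_rcons mem_head !orbT.
by move: Uc; rewrite ey ez mem_rcons mem_head !andbF.
Qed.

Lemma connect_root v :
  connect (fun u w => [set u; w] \in tree_edges) v r.
Proof.
have [n] := ubnP (d v); elim: n v => // n IHn v dv.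
have [->|vr] := eqVneq v r; first exact: connect0.
have [_ pv] := parentP vr.
apply: (@connect_trans _ _ (p v)); last by apply: IHn; apply: leq_trans pv dv.
by apply/connect1/tree_edgeP; left.
Qed.

(** The ends of an edge [xy] are joined by a simple path of tree edges; if [xy]
    is not one of these, it closes the path into a cycle. *)
Lemma acyclic_tree_edges : acyclic_graph G -> edges G = tree_edges.
Proof.
move=> acy; apply/eqP; rewrite eqEsubset tree_edges_sub andbT.
apply/subsetP=> A /edgesP[x [y [xy ->]]].
pose te : rel G := fun u w => [set u; w] \in tree_edges.
have te_sym : connect_sym te.
  by apply: sym_connect_sym => u w; rewrite /te setUC.
have : connect te x y.
  apply: (connect_trans (connect_root x)).
  by rewrite te_sym; apply: connect_root.
case/connectP=> s0 xs0 yE; case/shortenP: xs0 yE => s xs Us _ yE {s0}.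
have te_adj : subrel te (@adj G).
  move=> u w /(subsetP tree_edges_sub)/edgesP[a [b [ab]]].
  by case/set2_inj=> [[-> ->]|[-> ->]] //; rewrite adj_sym.
have /acy : ucycle (@adj G) (x :: s).
  rewrite /ucycle Us andbT /= rcons_path -yE adj_sym xy andbT.
  exact: sub_path xs.
(* A cycle of size at most two leaves only the path made of the edge itself. *)
case: s xs yE {Us} => [|w [|//]] /=.
  by move=> _ yx; rewrite yx adj_irrefl in xy.
by rewrite andbT => xw ->.
Qed.

End Rooted.

Lemma connected_card_edges :
  connected_graph G ->
  #|G| <= #|edges G|.+1 /\ (#|G| = #|edges G|.+1 <-> acyclic_graph G).
Proof.
case/andP=> /card_gt0P[r _] /forallP/(_ r)/forallP conn.
have [p [d parentP]] := spanning_tree_exists conn.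
have sub := tree_edges_sub parentP; have cardE := card_tree_edges parentP.
split; first by rewrite -cardE ltnS subset_leq_card.
split=> [eqG|/(acyclic_tree_edges parentP)->]; last by rewrite cardE.
apply: (tree_edges_acyclic parentP); apply/esym/eqP.
by rewrite eqEcard sub -ltnS cardE eqG ltnSn.
Qed.

End SpanningTree.

(** * Edges of a graph with a vertex cover *)

Section Cover.
Variables (G : sgraph) (C : {set G}).

Lemma card_induced : #|induced C| = #|C|.
Proof. by rewrite card_sig; apply: eq_card => x; rewrite !inE. Qed.

Lemma card_edges_induced :
  #|edges (induced C)| = #|[set A in edges G | A \subset C]|.
Proof.
rewrite -(card_imset _ (imset_inj (val_inj : injective (val : induced C -> G)))).
apply: eq_card => A; rewrite inE; apply/imsetP/andP.
  case=> _ /edgesP[x [y [xy ->]]] ->; rewrite imsetU1 imset_set1; split.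
    exact: mem_edges.
  by rewrite subUset !sub1set !(valP x, valP y).
case=> /edgesP[x [y [xy ->]]]; rewrite subUset !sub1set => /andP[xC yC].
exists [set (Sub x xC : induced C); (Sub y yC : induced C)].
  exact: (@mem_edges (induced C)).
by rewrite imsetU1 imset_set1.
Qed.

Hypothesis coverC : vertex_cover C.

Lemma vertex_cover_adj (x y : G) : adj x y -> x \notin C -> y \in C.
Proof.
move=> xy xC; have /set0Pn[z] := forall_inP coverC _ (mem_edges xy).
rewrite !inE => /andP[+ /orP[] /eqP zE]; rewrite zE //.
by rewrite (negPf xC).
Qed.

(** An edge not inside [C] has exactly one end outside [C], so it corresponds
    to a unique pair of a vertex [v] outside [C] and a neighbour of [v]. *)
Lemma card_edges_outside :
  #|[set A in edges G | ~~ (A \subset C)]| = \sum_(v in ~: C) degree v.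
Proof.
pose P := [set u : G * G | (u.1 \in ~: C) && adj u.1 u.2].
have -> : [set A in edges G | ~~ (A \subset C)] = [set [set u.1; u.2] | u in P].
  apply/setP=> A; rewrite inE; apply/andP/imsetP.
    case=> /edgesP[x [y [xy ->]]]; rewrite subUset !sub1set negb_and.
    case/orP=> nC; first by exists (x, y); rewrite // !inE nC.
    by exists (y, x); rewrite 1?setUC // !inE /= nC adj_sym.
  case=> [[x y] xyP ->]; move: xyP.
  rewrite [_ \in P]inE in_setC /= => /andP[xC xy]; split.
    exact: mem_edges.
  by rewrite subUset sub1set (negPf xC).
rewrite card_in_imset => [|[x y] [z t]]; last first.
  rewrite !inE /= => /andP[xC xy] /andP[zC zt] /set2_inj[[-> ->] //|[xt _]].
  by rewrite xt (vertex_cover_adj zt zC) in xC.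
under eq_bigr do rewrite /degree -sum1_card.
rewrite pair_big_dep -sum1_card.
by apply: eq_bigl => u; rewrite !inE.
Qed.

Lemma card_edges_cover :
  #|edges G| = #|edges (induced C)| + \sum_(v in ~: C) degree v.
Proof.
rewrite card_edges_induced -card_edges_outside.
rewrite -(cardsID [set A : {set G} | A \subset C] (edges G)).
by congr (_ + _); apply: eq_card => A; rewrite !inE // andbC.
Qed.

End Cover.

Section ConnectedCover.
Variables (G : sgraph) (C : {set G}).
Hypotheses (Gdeg : 2 <= min_degree G) (CVC : connected_vertex_cover C).

Lemma degree_sum_leqif :
  2 * #|~: C| <= \sum_(v in ~: C) degree v
    ?= iff [forall v in ~: C, 2 == degree v].
Proof.
rewrite mulnC -sum_nat_const; apply: leqif_sum => v _; split=> //.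
exact: leq_trans Gdeg (leq_min_degree v).
Qed.

Lemma connected_cover_bound : 2 * #|G| <= #|C| + #|edges G| + 1.
Proof.
case/andP: CVC => cov conn; have [le_tree _] := connected_card_edges conn.
rewrite card_induced in le_tree; have [le_deg _] := degree_sum_leqif.
have := card_edges_cover cov; have := cardsC C; lia.
Qed.

Lemma connected_cover_bound_eq :
  2 * #|G| = #|C| + #|edges G| + 1 <->
  is_tree (induced C) /\ (forall v : G, v \notin C -> degree v = 2).
Proof.
case/andP: CVC => cov conn.
have [le_tree eq_tree] := connected_card_edges conn.
rewrite card_induced in le_tree eq_tree; have [le_deg eq_deg] := degree_sum_leqif.
have mE := card_edges_cover cov; have nE := cardsC C.
split=> [tight|[[_ acy] deg2]].
  split; first by split=> //; apply/eq_tree; lia.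
  have /forall_inP deg2 : [forall v in ~: C, 2 == degree v].
    by rewrite -eq_deg; apply/eqP; lia.
  by move=> v vC; apply/esym/eqP/deg2; rewrite inE.
have eC := eq_tree.2 acy.
have /eqP : 2 * #|~: C| == \sum_(v in ~: C) degree v.
  by rewrite eq_deg; apply/forall_inP=> v; rewrite inE => /deg2->.
lia.
Qed.

End ConnectedCover.

(** * Minimum connected vertex covers *)

(** This makes the starting point of the minimization in [cvc] admissible, so
    that [cvc] is an attained minimum and not a default value. *)
Lemma connected_vertex_cover_setT (G : sgraph) :
  connected_graph G -> connected_vertex_cover [set: G].
Proof.
case/andP=> G_gt0 /forallP conn; apply/andP; split.
  apply/forall_inP=> _ /edgesP[x [y [_ ->]]]; rewrite setTI.
  by apply/set0Pn; exists x; rewrite set21.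
apply/andP; split; first by rewrite card_induced cardsT.
apply/forallP=> u; apply/forallP=> v.
have /connectP[s us vE] := forallP (conn (val u)) (val v).
pose lift (x : G) : induced [set: G] := Sub x (in_setT x).
apply/connectP; exists (map lift s).
  have -> : u = lift (val u) by apply: val_inj.
  by rewrite path_map.
have -> : u = lift (val u) by apply: val_inj.
by apply: val_inj; rewrite last_map -vE.
Qed.

Lemma cvcP (G : sgraph) :
  connected_graph G ->
  (exists C : {set G}, minimum_connected_vertex_cover C) /\
  (forall C : {set G}, connected_vertex_cover C -> cvc G <= #|C|).
Proof.
move=> /connected_vertex_cover_setT cvcT.
rewrite /minimum_connected_vertex_cover /cvc.
by case: arg_minnP => // C CVC Cmin; split; [exists C | ].
Qed.

Theorem lemma15 (G : sgraph) (Gconn : connected_graph G)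
    (Gdeg : 2 <= min_degree G) :
  [/\ (2 * #|G|%:Z - #|edges G|%:Z - 1 <= (cvc G)%:Z)%R,
      ((cvc G)%:Z = 2 * #|G|%:Z - #|edges G|%:Z - 1)%R <->
      (exists C : {set G},
         [/\ connected_vertex_cover C, is_tree (induced C)
           & forall v : G, v \notin C -> degree v = 2])
    & ((cvc G)%:Z = 2 * #|G|%:Z - #|edges G|%:Z - 1)%R ->
      forall C : {set G}, minimum_connected_vertex_cover C ->
        is_tree (induced C) /\ (forall v : G, v \notin C -> degree v = 2)].
Proof.
have [[C0 C0min] cvc_min] := cvcP Gconn.
have le_cvc : 2 * #|G| <= cvc G + #|edges G| + 1.
  by case: C0min => CVC <-; apply: connected_cover_bound.
have tight (C : {set G}) : minimum_connected_vertex_cover C ->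
    ((cvc G)%:Z = 2 * #|G|%:Z - #|edges G|%:Z - 1)%R ->
    is_tree (induced C) /\ (forall v : G, v \notin C -> degree v = 2).
  by case=> CVC cardC eqG; apply/(connected_cover_bound_eq Gdeg CVC); lia.
split; first by lia.
  split=> [/(tight _ C0min)[tree deg2]|[C [CVC tree deg2]]].
    by exists C0; split=> //; case: C0min.
  have := cvc_min _ CVC.
  have := (connected_cover_bound_eq Gdeg CVC).2 (conj tree deg2).
  lia.
by move=> eqG C Cmin; apply: tight.
Qed.
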